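(* Let $p_{n,m}:\mathrm{GF}(2)^{n+m}\to\mathrm{GF}(2)$ be the $n$ clique-line-$m$ clique function $$p_{n,m}(\mathbf{x})=\sum_{0\le i<j\le n-1}x_ix_j+x_{n-1}x_n+\sum_{n\le i<j\le n+m-1}x_ix_j,$$ and let $K^{IHN}_{n,m}$ be the number of flat spectra of $p_{n,m}$ with respect to $\{I,H,N\}^{n+m}$. Then $$K^{IHN}_{n,m}=2^{n+m-3}(3nm+2n+2m+2).$$
   Context: Let $I$ be the $2\times 2$ identity matrix, $H=\frac{1}{\sqrt2}\begin{pmatrix}1&1\\1&-1\end{pmatrix}$, and $N=\frac{1}{\sqrt2}\begin{pmatrix}1&i\\1&-i\end{pmatrix}$ with $i^2=-1$. $\{I,H,N\}^r$ denotes the set of $3^r$ transforms $U=U_0\otimes U_1\otimes\cdots\otimes U_{r-1}$ with each $U_j\in \{I,H,N\}$ (the factor $U_j$ acts on the tensor position of variable $x_j$); each transform is identified with the choice $(U_0,\ldots,U_{r-1})$. For a Boolean function $p:\mathrm{GF}(2)^r\to\mathrm{GF}(2)$, let $(-1)^{p}\in\mathbb{C}^{2^r}$ be the vector with entries $(-1)^{p(\mathbf{x})}$ indexed by $\mathbf{x}=(x_0,\ldots,x_{r-1})\in\mathrm{GF}(2)^r$. The spectrum of $p$ with respect to $U$ is $P=U(-1)^p=(P_{\mathbf{k}})_{\mathbf{k}\in\mathrm{GF}(2)^r}$, and it is flat if $|P_{\mathbf{k}}|=1$ for all $\mathbf{k}$. The number of flat spectra of $p$ with respect to $\{I,H,N\}^r$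 is the number of choices $(U_0,\ldots,U_{r-1})$ for which the spectrum of $p$ is flat. Here $n$ and $m$ are the numbers of variables in the two cliques, and $r=n+m$.
   Formalization: The formal statement assumes n ≥ 2 and m ≥ 2; the formula is false when n = 1 or m = 1 (e.g. n = m = 1 gives 4.5, and n = 1, m = 2 gives 14 while the true count is 16), and p_{n,m} is undefined for n = 0 or m = 0. *)

(* Defs.v *)
From HB Require Import structures.
From mathcomp Require Import all_boot all_order all_algebra.

Set Implicit Arguments.
Unset Strict Implicit.
Unset Printing Implicit Defensive.

Import Order.TTheory GRing.Theory Num.Theory.
Local Open Scope ring_scope.

Inductive ihn := TransI | TransH | TransN.

Definition ord_of_ihn (t : ihn) : 'I_3 :=
  match t with
  | TransI => inord 0
  | TransH => inord 1
  | TransN => inord 2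
  end.

Definition ihn_of_ord (i : 'I_3) : ihn :=
  nth TransI [:: TransI; TransH; TransN] i.

Lemma ord_of_ihnK : cancel ord_of_ihn ihn_of_ord.
Proof. by case; rewrite /ihn_of_ord /= inordK. Qed.

HB.instance Definition _ := Finite.copy ihn (can_type ord_of_ihnK).

(* C stands for the complex numbers: R[i] over any real closed field R is a
   numClosedFieldType. *)
Section Spectra.

Variable C : numClosedFieldType.

Definition mx2 (a b c d : C) : 'M[C]_2 :=
  \matrix_(k, l) (if k == 0 then (if l == 0 then a else b)
                  else (if l == 0 then c else d)).

Definition ihn_mx (t : ihn) : 'M[C]_2 :=
  match t with
  | TransI => 1%:M
  | TransH => (sqrtC 2)^-1 *: mx2 1 1
                                  1 (-1)
  | TransN => (sqrtC 2)^-1 *: mx2 1 'i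
                                  1 (- 'i)
  end.

(* Entry (k, x) of U_0 (x) ... (x) U_(r-1), rows and columns being indexed by
   GF(2)^r rather than by 0, ..., 2^r - 1.  'F_2 is convertible to 'I_2, so
   that the coordinates of k and x directly index the 2 x 2 factors. *)
Definition tensor_entry (r : nat) (U : {ffun 'I_r -> ihn})
    (k x : 'rV['F_2]_r) : C :=
  \prod_(j < r) ihn_mx (U j) (k 0 j) (x 0 j).

Definition spectrum (r : nat) (p : 'rV['F_2]_r -> 'F_2)
    (U : {ffun 'I_r -> ihn}) (k : 'rV['F_2]_r) : C :=
  \sum_(x : 'rV['F_2]_r) tensor_entry U k x * (-1) ^+ (p x : nat).

Definition flat (r : nat) (p : 'rV['F_2]_r -> 'F_2)
    (U : {ffun 'I_r -> ihn}) : bool :=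
  [forall k : 'rV['F_2]_r, `|spectrum p U k| == 1].

Definition num_flat (r : nat) (p : 'rV['F_2]_r -> 'F_2) : nat :=
  #|[set U : {ffun 'I_r -> ihn} | flat p U]|.

End Spectra.

(* The variable x_i for a natural number i; the default 0 is only used when
   i >= r. *)
Definition var (r : nat) (x : 'rV['F_2]_r) (i : nat) : 'F_2 :=
  if insub i is Some j then x 0 j else 0.

Definition clique_line_clique (n m : nat) (x : 'rV['F_2]_(n + m)) : 'F_2 :=
  \sum_(0 <= i < n) \sum_(i.+1 <= j < n) var x i * var x j
  + var x n.-1 * var x n
  + \sum_(n <= i < n + m) \sum_(i.+1 <= j < n + m) var x i * var x j.

(* Main.v *)
(* On a clique the exponent is w (w - 1) / 2 for a point of weight w, so that
   (-1)^exponent = sum over e = +-1 of c_e (e i)^w, c_e = (1 - e i) / 2: the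
   sign is a combination of two product functions.  Fixing the value a of the
   endpoint of the joining line in each clique, the spectrum becomes
   sum_(a, b) (-1)^(a b) u_a v_b, where u and v only depend on one clique each.
   Outside the endpoint, two or more N's make u vanish for some k; otherwise
   the rest of the clique acts, up to phases, as a single neighbour of the
   endpoint transformed by I (no N, evenly many H's), H (no N, oddly many H's)
   or N (exactly one N).  Hence u is, up to a phase, a standard basis vector,
   (1, +-1) / sqrt 2 or (1, +- i) / sqrt 2, or it vanishes for some k, and the
   spectrum is flat exactly when the kinds of u and v are both "basis", both
   "(1, +-1)", or distinct and one of them is "(1, +- i)".  In a clique of n
   vertices the three kinds arise (n + 2) 2^(n-2), n 2^(n-2) and n 2^(n-2)
   times. *)
Require Import Defs.
From mathcomp Require Import all_boot all_order all_algebra.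
From mathcomp Require Import ring.

Set Implicit Arguments.
Unset Strict Implicit.
Unset Printing Implicit Defensive.

Import Order.TTheory GRing.Theory Num.Theory.
Local Open Scope ring_scope.

(** * Sums and signs over GF(2) and over the three transforms *)

Lemma F2P (a : 'F_2) : a = 0 \/ a = 1.
Proof. by case: a => [[|[|]] i] //=; [left | right]; apply/val_inj. Qed.

Lemma sumF2 (V : nmodType) (F : 'F_2 -> V) : \sum_(a : 'F_2) F a = F 0 + F 1.
Proof.
rewrite (bigD1 0) //= (bigD1 1) //= big1 ?addr0 // => a.
by case: (F2P a) => ->.
Qed.

Lemma sum_ihn (V : nmodType) (F : ihn -> V) :
  \sum_t F t = F TransI + F TransH + F TransN.
Proof.
have HI : TransH != TransI by apply/eqP.
have NI : TransN != TransI by apply/eqP.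
have NH : TransN != TransH by apply/eqP.
rewrite (bigD1 TransI) // (bigD1 TransH) ?HI // (bigD1 TransN) ?NI ?NH //.
rewrite big1; first by rewrite /= addr0 !addrA.
by case; rewrite ?eqxx ?andbF.
Qed.

Lemma sgnF2D (R : comPzRingType) (a b : 'F_2) :
  (-1) ^+ (a + b)%R = (-1) ^+ a * (-1) ^+ b :> R.
Proof. by case: (F2P a) => ->; case: (F2P b) => ->; rewrite -exprD // sqrrN expr1n. Qed.

Lemma sgnF2_sum (R : comPzRingType) (I : Type) (r : seq I) (P : pred I) (F : I -> 'F_2) :
  (-1) ^+ (\sum_(i <- r | P i) F i)%R = \prod_(i <- r | P i) (-1) ^+ F i :> R.
Proof. by apply: (big_morph (fun a : 'F_2 => (-1) ^+ a)) => // a b; exact: sgnF2D. Qed.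

(** Distributivity of a product over sums, with the sum at [i0] restricted to the single value
    [u]. *)
Lemma sum_ffun_pin (R : comPzSemiRingType) (I T : finType) (i0 : I) (u : T) (F : I -> T -> R) :
  \sum_(f : {ffun I -> T} | f i0 == u) \prod_j F j (f j)
  = F i0 u * \prod_(j | j != i0) \sum_c F j c.
Proof.
pose Q j := [pred c : T | (j == i0) ==> (c == u)].
transitivity (\prod_j \sum_(c | Q j c) F j c); last first.
  rewrite (bigD1 i0) //=; congr (_ * _).
    by rewrite eqxx /= big_pred1_eq.
  by apply: eq_bigr => j /negPf ->.
rewrite bigA_distr_big_dep; apply: eq_bigl => f.
apply/eqP/familyP => [fu j|/(_ i0)]; rewrite /Q unfold_in /=; last first.
  by rewrite eqxx => /eqP.
by apply/implyP => /eqP ->; apply/eqP.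
Qed.

(** * Kinds of transforms on one clique with endpoint [i0] *)

Definition numH n (i0 : 'I_n) (U : {ffun 'I_n -> ihn}) : nat :=
  \sum_(j | j != i0) (U j == TransH).

Definition numN n (i0 : 'I_n) (U : {ffun 'I_n -> ihn}) : nat :=
  \sum_(j | j != i0) (U j == TransN).

Section Types.
Variables (n : nat) (i0 : 'I_n).
Implicit Types (U : {ffun 'I_n -> ihn}).

(* The three cases in which the vertices other than i0 act together like a
   single neighbour of i0 transformed by I, H and N respectively. *)
Definition rest_even U := (numN i0 U == 0%N) && ~~ odd (numH i0 U).
Definition rest_odd U := (numN i0 U == 0%N) && odd (numH i0 U).
Definition rest_one U := numN i0 U == 1%N.

(* The kind of vector, for every k, contributed by the clique: see basis_vec,
   real_vec and imag_vec below. *)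
Definition basis_type U :=
  if U i0 is TransI then rest_even U || rest_one U else rest_odd U.
Definition real_type U :=
  match U i0 with TransI => false | TransH => rest_even U | TransN => rest_one U end.
Definition imag_type U :=
  match U i0 with TransI => false | TransH => rest_one U | TransN => rest_even U end.

Lemma types_exclusive U :
  (basis_type U -> real_type U = false) /\ (basis_type U || real_type U -> imag_type U = false).
Proof.
rewrite /basis_type /real_type /imag_type /rest_even /rest_odd /rest_one.
by case: (U i0); case: numN => [|[|?]]; case: odd.
Qed.

End Types.

(** * Gluing transforms and points of two cliques *)

Definition ffun_join n m (T : Type) (U : {ffun 'I_n -> T}) (V : {ffun 'I_m -> T}) :
    {ffun 'I_(n + m) -> T} :=
  [ffun i => match split i with inl j => U j | inr j => V j end].

Lemma ffun_join_bij n m T :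
  bijective (fun UV : {ffun 'I_n -> T} * {ffun 'I_m -> T} => ffun_join UV.1 UV.2).
Proof.
exists (fun W : {ffun 'I_(n + m) -> T} => ([ffun i => W (lshift m i)], [ffun i => W (rshift n i)])).
  case=> U V; congr (_, _); apply/ffunP => i; rewrite !ffunE.
    by rewrite (unsplitK (inl _ i)).
  by rewrite (unsplitK (inr _ i)).
move=> W; apply/ffunP => i; rewrite !ffunE.
by rewrite -{2}(splitK i); case: (split i) => j; rewrite ffunE.
Qed.

Lemma var_lshift n m (x : 'rV_n) (y : 'rV_m) (i : 'I_n) :
  var (row_mx x y) i = x 0 i.
Proof.
by rewrite /var (insubT (fun j => j < n + m)%N (ltn_ord (lshift m i))) -(row_mxEl x y);
  congr (row_mx _ _ _ _); apply/val_inj.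
Qed.

Lemma var_rshift n m (x : 'rV_n) (y : 'rV_m) (i : 'I_m) :
  var (row_mx x y) (n + i) = y 0 i.
Proof.
by rewrite /var (insubT (fun j => j < n + m)%N (ltn_ord (rshift n i))) -(row_mxEr x y);
  congr (row_mx _ _ _ _); apply/val_inj.
Qed.

(** * Clique signs as combinations of product functions *)

Section Spectra.
Variable C : numClosedFieldType.
Implicit Types (e : bool).

(* The primitive fourth root of unity i for e = false, -i for e = true. *)
Definition iroot e : C := (-1) ^+ e * 'i.
Definition icoef e : C := (1 - iroot e) / 2.

(** Induction on the number of vertices, peeling off the lowest one. The interval is arbitrary so
    that both cliques are covered. *)
Lemma clique_sign (v : nat -> 'F_2) (l r : nat) :
  (-1) ^+ (\sum_(l <= i < r) \sum_(i.+1 <= j < r) v i * v j)%R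
  = \sum_e icoef e * \prod_(l <= i < r) iroot e ^+ v i :> C.
Proof.
have iE := sqrCi C.
(* For [r < l] the range is empty and both sides are 1, since the two coefficients [icoef] sum to
   1. *)
have [/subnKC <-|rl] := leqP l r; last first.
  rewrite big_geq ?(ltnW rl)// expr0 big_bool /= !big_geq ?(ltnW rl)//.
  rewrite /icoef /iroot; by field.
move: (r - l)%N => d; elim: d l => [|d IH] l.
  rewrite addn0 big_geq // expr0 big_bool /= !big_geq ?leqnn//.
  rewrite /icoef /iroot; by field.
have lt : (l < l + d.+1)%N by rewrite addnS ltnS leq_addr.
have prodE e : \prod_(l <= i < l + d.+1) iroot e ^+ v i
    = iroot e ^+ v l * \prod_(l.+1 <= i < l.+1 + d) iroot e ^+ v i.
  by rewrite big_ltn // addSnnS.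
rewrite big_ltn // sgnF2D -addSnnS IH addSnnS !big_bool /= !prodE -mulr_sumr addSnnS.
case: (F2P (v l)) => ->; first by rewrite mul0r !expr0 !mul1r.
rewrite mul1r sgnF2_sum.
(* Adding a vertex with value 1 multiplies the sign by (-1) ^+ (sum of the other
   values), which exchanges the two products. *)
have -> : \prod_(l.+1 <= j < l + d.+1) iroot true ^+ v j =
  \prod_(l.+1 <= j < l + d.+1) (-1) ^+ v j * \prod_(l.+1 <= j < l + d.+1) iroot false ^+ v j.
  by rewrite -big_split; apply: eq_bigr => j _ /=; rewrite -exprMn /iroot /= mul1r.
set s := \prod_(_ <= _ < _) _; set p := \prod_(_ <= _ < _) _.
have s2 : s * s = 1.
  rewrite -big_split big1 // => j _ /=.
  by rewrite -exprD addnn -mul2n exprM sqrrN expr1n expr1n.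
rewrite /icoef /iroot /= !expr1 expr0 mul1r mulN1r opprK.
apply: (@mulfI _ 2); first by rewrite pnatr_eq0.
transitivity ((1 + 'i) * (s * s) * p + (1 - 'i) * s * p); first by field.
rewrite s2; transitivity (('i - 'i ^+ 2) * p + (- 'i - 'i^+2) * s * p); last by field.
by rewrite iE; ring.
Qed.

(** Entry [b] of the transform [t] applied to the vector $(1, \pm i)$, the contribution of one
    vertex to a product function. *)
Definition factor e (t : ihn) (b : 'F_2) : C := \sum_c ihn_mx C t b c * iroot e ^+ c.

(* The component u_a: the clique sum restricted to x_(i0) = a, in closed form. *)
Definition port n (i0 : 'I_n) (U : {ffun 'I_n -> ihn}) (k : 'rV['F_2]_n) (a : 'F_2) : C :=
  \sum_e icoef e * (ihn_mx C (U i0) (k 0 i0) a * iroot e ^+ a)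
         * \prod_(j | j != i0) factor e (U j) (k 0 j).

(** For each [e] the summand is a product over the coordinates, so fixing coordinate [i0] leaves a
    product of independent sums. *)
Lemma sum_tensor_entry_port n (i0 : 'I_n) U k a :
  \sum_(x : 'rV['F_2]_n | x 0 i0 == a)
     tensor_entry C U k x * \sum_e icoef e * \prod_(j < n) iroot e ^+ x 0 j
  = port i0 U k a.
Proof.
under eq_bigr do rewrite mulr_sumr.
rewrite exchange_big; apply: eq_bigr => e _ /=.
rewrite -mulrA -(sum_ffun_pin i0 a (fun j c => ihn_mx C (U j) (k 0 j) c * iroot e ^+ c)).
rewrite mulr_sumr (reindex (fun f : {ffun 'I_n -> 'F_2} => \row_j f j)) /=; last first.
  exists (fun x : 'rV_n => [ffun j => x 0 j]) => f _.
    by apply/ffunP => j; rewrite ffunE mxE.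
  by apply/rowP => j; rewrite mxE ffunE.
apply: eq_big => [f|f _]; first by rewrite mxE.
rewrite mulrCA -big_split; congr (_ * _).
by apply: eq_bigr => j _; rewrite mxE.
Qed.

(** The sign of the clique at [x], by [clique_sign]. *)
Definition clique_sum n (x : 'rV['F_2]_n) : C :=
  \sum_e icoef e * \prod_(j < n) iroot e ^+ x 0 j.

Lemma clique_line_clique_sign n m (x : 'rV['F_2]_n.+1) (y : 'rV['F_2]_m.+1) :
  (-1) ^+ (@clique_line_clique n.+1 m.+1 (row_mx x y))
  = (-1) ^+ (x 0 ord_max * y 0 ord0)%R * clique_sum x * clique_sum y :> C.
Proof.
rewrite /clique_line_clique !sgnF2D !clique_sign.
have -> : var (row_mx x y) n.+1.-1 = x 0 ord_max by rewrite -(var_lshift x y).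
have -> : var (row_mx x y) n.+1 = y 0 ord0.
  by rewrite -(var_rshift x y) /= addn0.
have xE e : \prod_(0 <= i < n.+1) iroot e ^+ var (row_mx x y) i
          = \prod_(j < n.+1) iroot e ^+ x 0 j.
  by rewrite big_mkord; apply: eq_bigr => j _; rewrite var_lshift.
have yE e : \prod_(n.+1 <= i < n.+1 + m.+1) iroot e ^+ var (row_mx x y) i
          = \prod_(j < m.+1) iroot e ^+ y 0 j.
  rewrite -{1}(add0n n.+1) big_addn addKn big_mkord.
  by apply: eq_bigr => j _; rewrite [(j + _)%N]addnC var_rshift.
under eq_bigr do rewrite xE.
under [X in _ * _ * X = _]eq_bigr do rewrite yE.
by rewrite (mulrC (\sum_e _)).
Qed.

(** Everything splits over the two cliques except the joining line, whose ends are the last variable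
    of the first clique and the first of the second. Points are grouped by these two values. *)
Lemma spectrum_join n m (U : {ffun 'I_n.+1 -> ihn}) (V : {ffun 'I_m.+1 -> ihn}) k l :
  spectrum C (@clique_line_clique n.+1 m.+1) (ffun_join U V) (row_mx k l)
  = \sum_(a : 'F_2) \sum_(b : 'F_2)
      (-1) ^+ (a * b)%R * port ord_max U k a * port ord0 V l b.
Proof.
transitivity (\sum_(x : 'rV['F_2]_n.+1) \sum_(y : 'rV['F_2]_m.+1)
  (-1) ^+ (x 0 ord_max * y 0 ord0)%R
  * (tensor_entry C U k x * clique_sum x) * (tensor_entry C V l y * clique_sum y)).
  rewrite pair_big /spectrum.
  rewrite (reindex (fun p : 'rV['F_2]_n.+1 * 'rV['F_2]_m.+1 => row_mx p.1 p.2)); last first.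
    exists (fun z => (lsubmx z, rsubmx z)) => [[x y]|z] _ /=.
      by rewrite row_mxKl row_mxKr.
    by rewrite hsubmxK.
  apply: eq_bigr => [[x y]] _; rewrite clique_line_clique_sign.
  have -> : tensor_entry C (ffun_join U V) (row_mx k l) (row_mx x y)
            = tensor_entry C U k x * tensor_entry C V l y.
    rewrite /tensor_entry big_split_ord; congr (_ * _); apply: eq_bigr => j _.
      by rewrite !row_mxEl ffunE (unsplitK (inl _ j)).
    by rewrite !row_mxEr ffunE (unsplitK (inr _ j)).
  by rewrite mulrACA (mulrCA (tensor_entry C U k x)).
rewrite (partition_big (fun x : 'rV['F_2]_n.+1 => x 0 ord_max) predT) //.
apply: eq_bigr => a _; rewrite -sum_tensor_entry_port.
under eq_bigr => x _ do
  rewrite (partition_big (fun y : 'rV['F_2]_m.+1 => y 0 ord0) predT) //.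
rewrite exchange_big; apply: eq_bigr => b _.
rewrite -mulrA [X in _ = _ * X]mulr_suml [RHS]mulr_sumr; apply: eq_bigr => x.
rewrite andTb => /eqP ->; rewrite -sum_tensor_entry_port mulrA [RHS]mulr_sumr.
by apply: eq_bigr => y; rewrite andTb => /eqP ->.
Qed.

(** * Moduli, and the factor of a single vertex *)

Lemma iroot_sqr e : iroot e ^+ 2 = -1.
Proof. by rewrite exprMn sqrr_sign mul1r sqrCi. Qed.

Lemma iroot_neg e : iroot (~~ e) = - iroot e.
Proof. by rewrite /iroot signrN mulNr. Qed.

Lemma norm_iroot e : `|iroot e| = 1.
Proof. by rewrite normrM normrX normrN1 expr1n normCi mul1r. Qed.

Lemma normD1iroot e : `|1 + iroot e| ^+ 2 = 2.
Proof.
have -> : `|1 + iroot e| ^+ 2 = (1 + iroot e) * (1 - iroot e).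
  by rewrite normCK /iroot rmorphD rmorph1 rmorphM rmorph_sign /= conjCi mulrN.
by transitivity (1 - iroot e ^+ 2); [ring | rewrite iroot_sqr opprK].
Qed.

Lemma normB1iroot e : `|1 - iroot e| ^+ 2 = 2.
Proof. by rewrite -iroot_neg normD1iroot. Qed.

Lemma norm_icoef e : `|icoef e| ^+ 2 = 2^-1.
Proof.
rewrite normrM exprMn normB1iroot normfV normr_nat; by field.
Qed.

Lemma norm_sqrt2V : `|(sqrtC 2)^-1 : C| ^+ 2 = 2^-1.
Proof. by rewrite normfV ger0_norm ?sqrtC_ge0 // exprVn sqrtCK. Qed.

Lemma ihn_mxI (b c : 'F_2) : ihn_mx C TransI b c = (b == c)%:R.
Proof. by rewrite mxE. Qed.

Lemma ihn_mxH (b c : 'F_2) : ihn_mx C TransH b c = (sqrtC 2)^-1 * (-1) ^+ (b * c)%R.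
Proof.
by rewrite !mxE; case: (F2P b) => ->; case: (F2P c) => ->.
Qed.

Lemma ihn_mxN (b c : 'F_2) :
  ihn_mx C TransN b c = (sqrtC 2)^-1 * iroot (b == 1) ^+ c.
Proof.
by rewrite !mxE; case: (F2P b) => ->; case: (F2P c) => -> //=;
  rewrite /iroot /= ?mul1r ?mulN1r.
Qed.

Lemma factorI e b : factor e TransI b = iroot e ^+ b.
Proof.
rewrite /factor sumF2 !ihn_mxI.
by case: (F2P b) => ->; rewrite !eqxx ?mul1r mul0r ?addr0 ?add0r.
Qed.

Lemma factorH e b : factor e TransH b = (sqrtC 2)^-1 * (1 + (-1) ^+ b * iroot e).
Proof. by rewrite /factor sumF2 !ihn_mxH mulr0 mulr1 !expr0 !mulr1 -mulrA mulrDr mulr1. Qed.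

Lemma factorN e b :
  factor e TransN b = (sqrtC 2)^-1 * (1 + iroot (b == 1) * iroot e).
Proof. by rewrite /factor sumF2 !ihn_mxN !expr0 !mulr1 -mulrA mulrDr mulr1. Qed.

(** Under I or H the two product functions give factors of equal modulus; their ratio is real for I
    and imaginary for H. *)
Lemma factor_IH t b : t != TransN ->
  `|factor false t b| = 1 /\
  exists s : bool, factor true t b = (-1) ^+ s * 'i ^+ (t == TransH) * factor false t b.
Proof.
have iE := sqrCi C; case: t => [_|_|/eqP//].
  rewrite !factorI normrX norm_iroot expr1n; split=> //; exists (b == 1).
  have -> : (TransI == TransH) = false by apply/negP => /eqP.
  by case: (F2P b) => ->; rewrite /iroot /= !expr0 ?expr1; ring.
rewrite !factorH eqxx; split.
  apply/eqP; rewrite -(@sqrp_eq1 C) // normrM exprMn norm_sqrt2V.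
  have -> : (-1) ^+ b * iroot false = iroot (b == 1).
    by case: (F2P b) => ->; rewrite /iroot !mul1r.
  by rewrite normD1iroot mulVf ?pnatr_eq0.
exists (b == 0); rewrite [RHS]mulrCA; congr (_ * _).
case: (F2P b) => ->; rewrite /iroot /= !expr0 !expr1.
  by transitivity (- 'i - 'i ^+ 2 : C); [rewrite iE; ring | ring].
by transitivity ('i - 'i ^+ 2 : C); [rewrite iE; ring | ring].
Qed.

(** N sends $(1, \pm i)$ to multiples of basis vectors: the output bit decides which of the two
    product functions survives. *)
Lemma factor_N b :
  `|factor (b == 0) TransN b| ^+ 2 = 2 /\ factor (b != 0) TransN b = 0.
Proof.
rewrite !factorN; have -> : b == 1 = (b != 0) by case: (F2P b) => ->.
rewrite -expr2 iroot_sqr subrr mulr0; split=> //.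
rewrite iroot_neg mulNr -expr2 iroot_sqr opprK.
rewrite normrM exprMn norm_sqrt2V (@normr_nat C 2); by field.
Qed.

(** * The three kinds of vectors and their coupling by the joining line *)

Definition basis_vec (u : 'F_2 -> C) := exists a, `|u a| = 1 /\ u (a + 1) = 0.

(** Up to a phase, $(1, \pm 1)/\sqrt2$; likewise [imag_vec] is $(1, \pm i)/\sqrt2$. *)
Definition real_vec (u : 'F_2 -> C) :=
  `|u 0| ^+ 2 = 2^-1 /\ exists s : bool, u 1 = (-1) ^+ s * u 0.

Definition imag_vec (u : 'F_2 -> C) :=
  `|u 0| ^+ 2 = 2^-1 /\ exists s : bool, u 1 = iroot s * u 0.

(** The bilinear form with matrix $\sqrt2 H$. *)
Definition line_form (u v : 'F_2 -> C) : C :=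
  \sum_(a : 'F_2) \sum_(b : 'F_2) (-1) ^+ (a * b)%R * u a * v b.

Lemma line_formE u v : line_form u v = u 0 * v 0 + u 0 * v 1 + u 1 * v 0 - u 1 * v 1.
Proof.
rewrite /line_form !sumF2 !mul0r mulr0 mulr1 !expr0 expr1 !mul1r mulN1r mulNr.
by rewrite !addrA.
Qed.

Lemma line_formC u v : line_form u v = line_form v u.
Proof. by rewrite !line_formE; ring. Qed.

Lemma norm_eq1 (x : C) : (`|x| == 1) = (`|x| ^+ 2 == 1).
Proof. by rewrite sqrp_eq1. Qed.

Lemma norm_sumdiff_basis v (s : bool) : basis_vec v -> `|v 0 + (-1) ^+ s * v 1| = 1.
Proof.
case=> a; case: (F2P a) => -> [].
  by rewrite add0r => v0 ->; rewrite mulr0 addr0.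
have -> : 1 + 1 = 0 :> 'F_2 by apply/val_inj.
by move=> v1 ->; rewrite add0r normrM normrX normrN1 expr1n mul1r.
Qed.

(** A basis vector selects one row of $\sqrt2 H$. *)
Lemma line_form_basisl u v : basis_vec u ->
  exists s : bool, `|line_form u v| = `|v 0 + (-1) ^+ s * v 1|.
Proof.
case=> a; case: (F2P a) => -> []; rewrite line_formE.
  rewrite add0r => u0 ->; exists false.
  by rewrite expr0 !mul0r addr0 subr0 mul1r -mulrDr normrM u0 mul1r.
have -> : 1 + 1 = 0 :> 'F_2 by apply/val_inj.
move=> u1 ->; exists true.
by rewrite expr1 !mul0r !add0r mulN1r -mulrBr normrM u1 mul1r.
Qed.

Lemma line_form_basis_basis u v : basis_vec u -> basis_vec v -> `|line_form u v| = 1.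
Proof. by move=> /(@line_form_basisl _ v)[s ->] /norm_sumdiff_basis ->. Qed.

(** The selected row gives either $2 v_0$, of squared modulus 2, or 0. *)
Lemma line_form_basis_real u v : basis_vec u -> real_vec v -> `|line_form u v| != 1.
Proof.
move=> /(@line_form_basisl _ v)[s ->] [v0 [t ->]]; rewrite norm_eq1 mulrA -signr_addb.
case: (s (+) t); last first.
  rewrite expr0 mul1r -mulr2n -mulr_natl normrM exprMn v0 normr_nat.
  have -> : 2 ^+ 2 * 2^-1 = 2 :> C by field.
  by rewrite (eqr_nat C 2 1).
by rewrite expr1 mulN1r subrr normr0 expr0n eq_sym oner_eq0.
Qed.

Lemma line_form_basis_imag u v : basis_vec u -> imag_vec v -> `|line_form u v| = 1.
Proof.
move=> /(@line_form_basisl _ v)[s ->] [v0 [t ->]]; apply/eqP; rewrite norm_eq1.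
have -> : v 0 + (-1) ^+ s * (iroot t * v 0) = (1 + iroot (s (+) t)) * v 0.
  by rewrite /iroot signr_addb; ring.
by rewrite normrM exprMn v0 normD1iroot divff ?pnatr_eq0.
Qed.

(** The matrix $\sqrt2 H$ maps $(1, \pm 1)$ to twice a basis vector, so a single entry of [v] is
    read off. *)
Lemma line_form_real u v : real_vec u ->
  exists b, `|line_form u v| ^+ 2 = 2 * `|v b| ^+ 2.
Proof.
case=> u0 [s u1]; rewrite line_formE u1; exists (if s then 1 else 0).
have -> : u 0 * v 0 + u 0 * v 1 + (-1) ^+ s * u 0 * v 0 - (-1) ^+ s * u 0 * v 1
  = 2 * u 0 * v (if s then 1 else 0).
  by case: s {u1}; rewrite ?expr1 ?expr0; ring.
rewrite !normrM !exprMn u0 normr_nat; by field.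
Qed.

Lemma line_form_real_unit u v : real_vec u -> real_vec v \/ imag_vec v ->
  `|line_form u v| = 1.
Proof.
move=> /(@line_form_real _ v)[b e] v_ri; apply/eqP; rewrite norm_eq1 e.
have -> : `|v b| ^+ 2 = 2^-1; last by rewrite divff ?pnatr_eq0.
case: (F2P b) => ->; case: v_ri => -[v0 [s vs]] //.
  by rewrite vs normrM normrX normrN1 expr1n mul1r.
by rewrite vs normrM norm_iroot mul1r.
Qed.

(** The coefficient of $u_0 v_0$ is $2(1 \pm i)$ for equal signs and 0 for opposite ones, so the
    squared modulus is 2 or 0. *)
Lemma line_form_imag_imag u v : imag_vec u -> imag_vec v -> `|line_form u v| != 1.
Proof.
case=> u0 [s u1] [v0 [t v1]]; rewrite norm_eq1 line_formE u1 v1.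
have -> : u 0 * v 0 + u 0 * (iroot t * v 0) + iroot s * u 0 * v 0
   - iroot s * u 0 * (iroot t * v 0)
   = (1 - iroot s * iroot t + (iroot t + iroot s)) * (u 0 * v 0) by ring.
have [<-|nst] := eqVneq s t.
  rewrite -expr2 iroot_sqr opprK -mulr2n.
  have -> : 1 + 1 + iroot s *+ 2 = 2 * (1 + iroot s) by ring.
  rewrite !normrM !exprMn u0 v0 normD1iroot normr_nat.
  have -> : 2 ^+ 2 * 2 * (2^-1 * 2^-1) = 2 :> C by field.
  by rewrite (eqr_nat C 2 1).
have -> : s = ~~ t by move: nst; case: (s); case: (t).
rewrite iroot_neg mulNr -expr2 iroot_sqr opprK subrr subrr add0r mul0r.
by rewrite normr0 expr0n eq_sym oner_eq0.
Qed.

(** * The clique outside the endpoint *)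

(** A port without the entry of the endpoint's own transform; [F e] stands for the product of the
    factors of the other vertices. *)
Definition rest_port (F : bool -> C) (a : 'F_2) : C :=
  \sum_e icoef e * iroot e ^+ a * F e.

Lemma rest_portE F a :
  rest_port F a = icoef true * iroot true ^+ a * F true
                  + icoef false * iroot false ^+ a * F false.
Proof. by rewrite /rest_port big_bool. Qed.

(** For ratio 1 the vector is $(1, 1)$ and for ratio $-1$ it is $(-i, i)$, times [F false]. *)
Lemma rest_port_even F (s : bool) : `|F false| = 1 -> F true = (-1) ^+ s * F false ->
  `|rest_port F 0| = 1 /\ exists t : bool, rest_port F 1 = (-1) ^+ t * rest_port F 0.
Proof.
move=> Ff Ft; have iE := sqrCi C; rewrite !rest_portE Ft /icoef /iroot /=.
rewrite !expr0 !expr1; case: s {Ft}; rewrite ?expr0 ?expr1; split.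
- have -> : (1 - -1 * 'i) / 2 * 1 * (-1 * F false) + (1 - 1 * 'i) / 2 * 1 * F false
            = - 'i * F false by field.
  by rewrite normrM normrN normCi Ff mul1r.
- by exists true; rewrite expr1; field.
- have -> : (1 - -1 * 'i) / 2 * 1 * (1 * F false) + (1 - 1 * 'i) / 2 * 1 * F false
            = F false by field.
  by [].
- exists false; rewrite expr0.
  transitivity (F false); last by field.
  by transitivity (- 'i ^+ 2 * F false); [field | rewrite iE; ring].
Qed.

(** For ratio $-i$ the vector is $(1-i, 0)$ and for ratio $i$ it is $(0, 1+i)$, times [F false]. *)
Lemma rest_port_odd F (s : bool) : `|F false| = 1 -> F true = (-1) ^+ s * 'i * F false ->
  exists a, `|rest_port F a| ^+ 2 = 2 /\ rest_port F (a + 1) = 0.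
Proof.
move=> Ff Ft; have iE := sqrCi C; exists (if s then 0 else 1).
have -> : (if s then 0 else 1) + 1 = (if s then 1 else 0) :> 'F_2.
  by case: s {Ft}; apply/val_inj.
rewrite !rest_portE Ft /icoef /iroot /=.
case: s {Ft}; rewrite !expr0 !expr1; split.
(* Multiples of $i^2 + 1$ are kept explicit: [field] treats ['i] as an indeterminate, and $i^2 = -1$
   is used afterwards. *)
- have -> : (1 - -1 * 'i) / 2 * 1 * (-1 * 'i * F false) + (1 - 1 * 'i) / 2 * 1 * F false
    = ((1 - 'i) + ((-1) - 'i ^+ 2) / 2) * F false.
    by field.
  by rewrite iE subrr mul0r addr0 normrM Ff mulr1 -[X in 1 - X]mul1r (normB1iroot false).
- transitivity (('i ^+ 2 + 1) * 'i / 2 * F false); first by field.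
  by rewrite iE addNr !mul0r.
- transitivity (`|(1 + 'i + (- 'i ^+ 2 - 1) * (2 + 'i) / 2) * F false| ^+ 2).
    by congr (`|_| ^+ 2); field.
  by rewrite iE opprK subrr !mul0r addr0 normrM Ff mulr1 -[X in 1 + X]mul1r (normD1iroot false).
- transitivity (('i ^+ 2 + 1) / 2 * F false); first by field.
  by rewrite iE addNr !mul0r.
Qed.

(** Only one product function survives, and it is proportional to $(1, \pm i)$. *)
Lemma rest_port_one F (e : bool) : `|F e| ^+ 2 = 2 -> F (~~ e) = 0 ->
  `|rest_port F 0| = 1 /\ exists t : bool, rest_port F 1 = iroot t * rest_port F 0.
Proof.
move=> Fe Fne.
have E a : rest_port F a = iroot e ^+ a * (icoef e * F e).
  rewrite rest_portE; case: e Fe Fne => _ /= ->;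
    by rewrite mulr0 ?addr0 ?add0r mulrA (mulrC (_ ^+ _)).
split; last by exists e; rewrite !E expr0 expr1 mul1r.
apply/eqP; rewrite norm_eq1 E expr0 mul1r normrM exprMn norm_icoef Fe.
by rewrite mulVf ?pnatr_eq0.
Qed.

Definition rest n (i0 : 'I_n) (U : {ffun 'I_n -> ihn}) (k : 'rV['F_2]_n) e : C :=
  \prod_(j | j != i0) factor e (U j) (k 0 j).

Lemma portE n (i0 : 'I_n) U k a :
  port i0 U k a = ihn_mx C (U i0) (k 0 i0) a * rest_port (rest i0 U k) a.
Proof.
rewrite /port /rest_port mulr_sumr; apply: eq_bigr => e _.
by rewrite -/(rest i0 U k e) mulrCA !mulrA.
Qed.

Lemma expi (h : nat) : exists s : bool, 'i ^+ h = (-1) ^+ s * 'i ^+ odd h :> C.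
Proof.
exists (odd h./2); rewrite signr_odd -sqrCi -exprM mul2n -exprD.
by rewrite addnC odd_double_half.
Qed.

(** The set of vertices is arbitrary, so that a single N can be set aside in [rest_oneN]. *)
Lemma prod_factor_IH n (P : pred 'I_n) (U : {ffun 'I_n -> ihn}) (k : 'rV['F_2]_n) :
  (forall j, P j -> U j != TransN) ->
  `|\prod_(j | P j) factor false (U j) (k 0 j)| = 1 /\
  exists s : bool, \prod_(j | P j) factor true (U j) (k 0 j)
    = (-1) ^+ s * 'i ^+ odd (\sum_(j | P j) (U j == TransH))
      * \prod_(j | P j) factor false (U j) (k 0 j).
Proof.
move=> PN.
have [n1 [s E]] : `|\prod_(j | P j) factor false (U j) (k 0 j)| = 1 /\
  exists s : bool, \prod_(j | P j) factor true (U j) (k 0 j)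
    = (-1) ^+ s * 'i ^+ (\sum_(j | P j) (U j == TransH))
      * \prod_(j | P j) factor false (U j) (k 0 j).
  elim/big_ind3: _ => [|x1 x2 h y1 y2 g [nx [s sx]] [ny [t ty]]|j Pj].
  - by rewrite normr1; split=> //; exists false; rewrite !mulr1.
  - rewrite normrM nx ny mulr1; split=> //; exists (s (+) t).
    by rewrite sx ty signr_addb exprD; ring.
  - exact/factor_IH/PN.
split=> //; have [t Et] := expi (\sum_(j | P j) (U j == TransH)).
by exists (s (+) t); rewrite E Et signr_addb mulrA.
Qed.

Lemma rest_noN n (i0 : 'I_n) U k : numN i0 U = 0%N ->
  `|rest i0 U k false| = 1 /\
  exists s : bool, rest i0 U k true
    = (-1) ^+ s * 'i ^+ odd (numH i0 U) * rest i0 U k false.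
Proof.
move=> N0; apply: prod_factor_IH => j ji; apply/negP => jN.
by move/eqP: N0; rewrite /numN (bigD1 j) // jN addn_eq0.
Qed.

Lemma rest_oneN n (i0 : 'I_n) U k : numN i0 U = 1%N ->
  exists e : bool, `|rest i0 U k e| ^+ 2 = 2 /\ rest i0 U k (~~ e) = 0.
Proof.
move=> N1.
have [j ji jN] : exists2 j, j != i0 & U j == TransN.
  case: (pickP [pred j | (j != i0) && (U j == TransN)]) => [j /andP[]|no].
    by exists j.
  by move: N1; rewrite /numN big1 // => j ji; move: (no j); rewrite /= ji /= => ->.
have oth l : (l != i0) && (l != j) -> U l != TransN.
  move=> /andP[li lj]; apply/negP => lN; move: N1.
  by rewrite /numN (bigD1 j) // (bigD1 l) ?li // jN lN /= !add1n.
have [n1 [s E]] := prod_factor_IH k oth.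
have [nf zf] := factor_N (k 0 j).
(* The output bit at the N vertex [j] determines the surviving product function. *)
exists (k 0 j == 0); split; rewrite /rest (bigD1 j) //= (eqP jN); last by rewrite zf mul0r.
rewrite normrM exprMn nf; case: (k 0 j == 0); last by rewrite n1 expr1n mulr1.
rewrite E !normrM n1 !normrX normrN1 normCi.
by rewrite !(expr1n, mulr1).
Qed.

Lemma rest_manyN n (i0 : 'I_n) U : (1 < numN i0 U)%N ->
  exists k, forall e, rest i0 U k e = 0.
Proof.
move=> N2.
have [j ji jN] : exists2 j, j != i0 & U j == TransN.
  case: (pickP [pred j | (j != i0) && (U j == TransN)]) => [j /andP[]|no].
    by exists j.
  by move: N2; rewrite /numN big1 // => j ji; move: (no j); rewrite /= ji /= => ->.
have [l /andP[li lj] lN] : exists2 l, (l != i0) && (l != j) & U l == TransN.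
  case: (pickP [pred l | (l != i0) && (l != j) && (U l == TransN)]) => [l /andP[]|no].
    by exists l.
  move: N2; rewrite /numN (bigD1 j) //= big1; first by case: (_ == _).
  by move=> l lij; move: (no l); rewrite /= lij /= => ->.
(* Opposite output bits at two N vertices: [j] kills the product function of [true], [l] that of
   [false]. *)
exists (\row_i (i == j)%:R) => e.
have [_ zj] := factor_N 1; have [_ zl] := factor_N 0.
rewrite /rest; case: e; [rewrite (bigD1 j) // | rewrite (bigD1 l) //].
  by rewrite mxE eqxx (eqP jN) zj /= mul0r.
by rewrite mxE (negPf lj) (eqP lN) zl /= mul0r.
Qed.

(** * The kind of the port vector of a clique *)

Section Ports.
Variables (n : nat) (i0 : 'I_n).
Implicit Types (U : {ffun 'I_n -> ihn}).

Lemma rest_port_evenU U k : rest_even i0 U ->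
  `|rest_port (rest i0 U k) 0| = 1 /\
  exists t : bool, rest_port (rest i0 U k) 1 = (-1) ^+ t * rest_port (rest i0 U k) 0.
Proof.
case/andP=> /eqP /(rest_noN k)[n1 [s E]] /negPf ho.
by apply: (rest_port_even (s := s)) => //; rewrite E ho mulr1.
Qed.

Lemma rest_port_oddU U k : rest_odd i0 U ->
  exists a, `|rest_port (rest i0 U k) a| ^+ 2 = 2 /\ rest_port (rest i0 U k) (a + 1) = 0.
Proof.
case/andP=> /eqP /(rest_noN k)[n1 [s E]] ho.
by apply: (rest_port_odd (s := s)) => //; rewrite E ho.
Qed.

Lemma rest_port_oneU U k : rest_one i0 U ->
  `|rest_port (rest i0 U k) 0| = 1 /\
  exists t : bool, rest_port (rest i0 U k) 1 = iroot t * rest_port (rest i0 U k) 0.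
Proof. by move=> /eqP /(rest_oneN k)[e [Fe Fne]]; apply: rest_port_one Fe Fne. Qed.

Lemma port_basis U k : basis_type i0 U -> basis_vec (port i0 U k).
Proof.
rewrite /basis_type; case Ui: (U i0).
- move=> t; exists (k 0 i0); rewrite !portE Ui !ihn_mxI eqxx mul1r; split; last first.
    by case: (F2P (k 0 i0)) => ->; rewrite mul0r.
  (* Under I at the endpoint only moduli matter: in both cases the two components of the rest have
     modulus 1. *)
  have [u0 [w [w1 E]]] : `|rest_port (rest i0 U k) 0| = 1 /\ exists w : C, `|w| = 1 /\
      rest_port (rest i0 U k) 1 = w * rest_port (rest i0 U k) 0.
    case/orP: t => [/(rest_port_evenU k)|/(rest_port_oneU k)] [u0 [s e]]; split=> //.
      by exists ((-1) ^+ s); rewrite normrX normrN1 expr1n.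
    by exists (iroot s); rewrite norm_iroot.
  by case: (F2P (k 0 i0)) => ->; rewrite ?E ?normrM ?w1 ?mul1r.
- move=> /(rest_port_oddU k)[a [na za]]; exists a; rewrite !portE Ui za mulr0; split=> //.
  apply/eqP; rewrite norm_eq1 ihn_mxH !normrM !exprMn norm_sqrt2V na.
  by rewrite normrX normrN1 !expr1n mulr1 mulVf ?pnatr_eq0.
- move=> /(rest_port_oddU k)[a [na za]]; exists a; rewrite !portE Ui za mulr0; split=> //.
  apply/eqP; rewrite norm_eq1 ihn_mxN !normrM normrX norm_iroot expr1n mulr1.
  by rewrite exprMn norm_sqrt2V na mulVf ?pnatr_eq0.
Qed.

Lemma port_0 U k : U i0 != TransI ->
  port i0 U k 0 = (sqrtC 2)^-1 * rest_port (rest i0 U k) 0.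
Proof.
rewrite portE; case: (U i0) => [/eqP//|_|_]; first by rewrite ihn_mxH mulr0 expr0 mulr1.
by rewrite ihn_mxN expr0 mulr1.
Qed.

Lemma norm_port_0 U k : U i0 != TransI -> `|rest_port (rest i0 U k) 0| = 1 ->
  `|port i0 U k 0| ^+ 2 = 2^-1.
Proof. by move=> /port_0 -> L0; rewrite normrM exprMn norm_sqrt2V L0 expr1n mulr1. Qed.

Lemma port_1H U k : U i0 = TransH ->
  port i0 U k 1 = (sqrtC 2)^-1 * ((-1) ^+ (k 0 i0 == 1) * rest_port (rest i0 U k) 1).
Proof.
rewrite portE => ->; rewrite ihn_mxH mulr1 mulrA; congr (_ * _ * _).
by case: (F2P (k 0 i0)) => ->.
Qed.

Lemma port_1N U k : U i0 = TransN ->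
  port i0 U k 1 = (sqrtC 2)^-1 * (iroot (k 0 i0 == 1) * rest_port (rest i0 U k) 1).
Proof. by rewrite portE => ->; rewrite ihn_mxN expr1 -mulrA. Qed.

Lemma port_real U k : real_type i0 U -> real_vec (port i0 U k).
Proof.
rewrite /real_type; case Ui: (U i0) => // t.
- have UI : U i0 != TransI by rewrite Ui; apply/eqP.
  have [u0 [s e]] := rest_port_evenU k t; split; first exact: norm_port_0.
  exists (s (+) (k 0 i0 == 1)); rewrite port_1H // port_0 // e signr_addb.
  by move: (k 0 i0 == 1) (rest_port _ _) => c L; ring.
- have UI : U i0 != TransI by rewrite Ui; apply/eqP.
  have [u0 [s e]] := rest_port_oneU k t; split; first exact: norm_port_0.
  (* The endpoint and the rest each contribute $\pm i$; the negation is the sign of $i^2$. *)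
  exists (~~ (s (+) (k 0 i0 == 1))); rewrite port_1N // port_0 // e signrN signr_addb.
  move: (k 0 i0 == 1) (rest_port _ _) => c L.
  transitivity ('i ^+ 2 * (-1) ^+ s * (-1) ^+ c * ((sqrtC 2)^-1 * L)).
    by rewrite /iroot; ring.
  by rewrite sqrCi; ring.
Qed.

Lemma port_imag U k : imag_type i0 U -> imag_vec (port i0 U k).
Proof.
rewrite /imag_type; case Ui: (U i0) => // t.
- have UI : U i0 != TransI by rewrite Ui; apply/eqP.
  have [u0 [s e]] := rest_port_oneU k t; split; first exact: norm_port_0.
  exists (s (+) (k 0 i0 == 1)); rewrite port_1H // port_0 // e /iroot signr_addb.
  by move: (k 0 i0 == 1) (rest_port _ _) => c L; ring.
- have UI : U i0 != TransI by rewrite Ui; apply/eqP.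
  have [u0 [s e]] := rest_port_evenU k t; split; first exact: norm_port_0.
  exists (s (+) (k 0 i0 == 1)); rewrite port_1N // port_0 // e /iroot signr_addb.
  by move: (k 0 i0 == 1) (rest_port _ _) => c L; ring.
Qed.

(** Two causes of vanishing: several N's in the rest, or I at the endpoint with an odd rest, where
    the output bit can select the zero component. *)
Lemma port_degenerate U : ~~ [|| basis_type i0 U, real_type i0 U | imag_type i0 U] ->
  exists k, forall a, port i0 U k a = 0.
Proof.
move=> bad; have [le1|N2] := leqP (numN i0 U) 1; last first.
  have [k z] := rest_manyN N2; exists k => a.
  by rewrite portE rest_portE !z !mulr0 addr0 mulr0.
have [Ui od] : U i0 = TransI /\ rest_odd i0 U.
  move: bad; rewrite /basis_type /real_type /imag_type /rest_even /rest_odd /rest_one.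
  by case: (U i0) => /=; move: le1; case: (numN i0 U) => [|[|]] //= _; case: odd.
have [a [na za]] := rest_port_oddU 0 od.
(* The rest ignores coordinate [i0] of [k], so the zero found at [k = 0] persists when that
   coordinate is set to its position [a + 1]. *)
have restE (k : 'rV['F_2]_n) : (forall j, j != i0 -> k 0 j = 0) -> rest i0 U k =1 rest i0 U 0.
  by move=> k0 e; apply: eq_bigr => j ji; rewrite k0 // mxE.
exists (\row_j (if j == i0 then a + 1 else 0)) => b.
rewrite portE Ui ihn_mxI mxE eqxx; case: eqVneq => [<-|_]; last by rewrite mul0r.
rewrite mul1r -[RHS]za !rest_portE !restE // => j ji; by rewrite mxE (negPf ji).
Qed.

End Ports.

(** The kind of a port is the same for every [k], so flatness depends only on the pair of kinds. *)
Lemma flat_join n m (U : {ffun 'I_n.+1 -> ihn}) (V : {ffun 'I_m.+1 -> ihn}) :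
  let b := basis_type ord_max U in let r := real_type ord_max U in
  let i := imag_type ord_max U in
  let b' := basis_type ord0 V in let r' := real_type ord0 V in
  let i' := imag_type ord0 V in
  flat C (@clique_line_clique n.+1 m.+1) (ffun_join U V)
  = (b && b' || b && i' || i && b' || r && r' || r && i' || i && r').
Proof.
move=> b r i b' r' i'.
have flatE : flat C (@clique_line_clique n.+1 m.+1) (ffun_join U V) <->
    forall k l, `|line_form (port ord_max U k) (port ord0 V l)| = 1.
  split=> [/forallP fl k l|fl].
    by rewrite -(eqP (fl (row_mx k l))) spectrum_join.
  apply/forallP => z; rewrite -(hsubmxK z) spectrum_join; exact/eqP/fl.
have notflat k l : `|line_form (port ord_max U k) (port ord0 V l)| != 1 ->
    flat C (@clique_line_clique n.+1 m.+1) (ffun_join U V) = false.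
  by move=> ne; apply/negP => /flatE/(_ k l)/eqP; rewrite (negPf ne).
have z1 : (`|0 : C| == 1) = false by rewrite normr0 eq_sym oner_eq0.
have [bri|] := boolP [|| b, r | i]; last first.
  move=> bad; have [k z] := port_degenerate bad.
  rewrite (notflat k 0); last by rewrite line_formE !z !mul0r !addr0 subr0 z1.
  by move: bad; case: (b) (r) (i) => [] [] [].
have [bri'|] := boolP [|| b', r' | i']; last first.
  move=> bad; have [l z] := port_degenerate bad.
  rewrite (notflat 0 l); last by rewrite line_formE !z !mulr0 !addr0 subr0 z1.
  by move: bad; case: (b') (r') (i') => [] [] [] //; case: (b) (r) (i) => [] [] [].
have [xb xr] := types_exclusive ord_max U.
have [xb' xr'] := types_exclusive ord0 V.
have := @port_basis _ ord_max U; have := @port_real _ ord_max U.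
have := @port_imag _ ord_max U; have := @port_basis _ ord0 V.
have := @port_real _ ord0 V; have := @port_imag _ ord0 V.
move: xb xr bri xb' xr' bri'; rewrite -/b -/r -/i -/b' -/r' -/i'.
(* Each side has exactly one kind, which leaves nine pairs; a single index refutes flatness in the
   bad ones. *)
case: (b) => [/(_ isT) -> /(_ isT) -> _|_];
  [|case: (r) => [/(_ isT) -> _|_ /= ->]];
  (case: (b') => [/(_ isT) -> /(_ isT) -> _|_];
  [|case: (r') => [/(_ isT) -> _|_ /= ->]]);
  move=> /= Vi Vr Vb Ui Ur Ub.
- by apply/flatE => k l; apply: line_form_basis_basis; auto.
- by apply: (notflat 0 0); apply: line_form_basis_real; auto.
- by apply/flatE => k l; apply: line_form_basis_imag; auto.
- by apply: (notflat 0 0); rewrite line_formC; apply: line_form_basis_real; auto.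
- by apply/flatE => k l; apply: line_form_real_unit; auto.
- by apply/flatE => k l; apply: line_form_real_unit; auto.
- by apply/flatE => k l; rewrite line_formC; apply: line_form_basis_imag; auto.
- by apply/flatE => k l; rewrite line_formC; apply: line_form_real_unit; auto.
- by apply: (notflat 0 0); apply: line_form_imag_imag; auto.
Qed.

End Spectra.

(** * Counting the transforms of each kind on a clique of [n + 2] vertices *)

Section Counting.
Variables (n : nat) (i0 : 'I_n.+2).
Implicit Types (U : {ffun 'I_n.+2 -> ihn}).

(* The coefficients of degree 0 and 1, at s = 1 and s = -1, count the three
   cases of the rest. *)
Lemma sum_numN_numH (s : int) u :
  \sum_(U : {ffun 'I_n.+2 -> ihn} | U i0 == u) (s ^+ numH i0 U)%:P * 'X^(numN i0 U)
  = ((1 + s)%:P + 'X) ^+ n.+1 :> {poly int}.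
Proof.
pose w t : {poly int} := (s ^+ (t == TransH))%:P * 'X^(t == TransN).
transitivity (\sum_(U : {ffun 'I_n.+2 -> ihn} | U i0 == u)
    \prod_j (if j == i0 then 1 else w (U j))).
  apply: eq_bigr => U _; rewrite (bigD1 i0) //= eqxx mul1r.
  rewrite /numH /numN (big_morph _ (exprD s) (expr0 s)).
  rewrite (big_morph _ (exprD 'X) (expr0 'X)) rmorph_prod -big_split /=.
  by apply: eq_bigr => j /negPf ->.
rewrite (sum_ffun_pin i0 u (fun j t => if j == i0 then 1 else w t)) eqxx mul1r.
transitivity (\prod_(j | j != i0) ((1 + s)%:P + 'X : {poly int})).
  apply: eq_bigr => j /negPf ->; rewrite sum_ihn /w !eqxx.
  have [-> -> -> ->] : [/\ TransI == TransH = false, TransI == TransN = false,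
      TransH == TransN = false & TransN == TransH = false].
    by split; apply/negP => /eqP.
  by rewrite !expr0 !expr1 !mulr1 mul1r rmorphD.
by rewrite prodr_const cardC1 card_ord.
Qed.

Lemma coef_sum_numN (s : int) u d :
  \sum_(U : {ffun 'I_n.+2 -> ihn} | U i0 == u) s ^+ numH i0 U * (numN i0 U == d)%:R
  = (((1 + s)%:P + 'X) ^+ n.+1)`_d :> int.
Proof.
rewrite -(sum_numN_numH s u) coef_sum; apply: eq_bigr => U _.
by rewrite coefCM coefXn eq_sym.
Qed.

(** The coefficient of $X$ in $(2 + X)^{n+1}$, extracted as the derivative at 0. *)
Lemma sum_rest_one u :
  (\sum_(U : {ffun 'I_n.+2 -> ihn} | U i0 == u) rest_one i0 U = n.+1 * 2 ^ n)%N.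
Proof.
apply/eqP; rewrite -(eqr_nat int) natr_sum; apply/eqP.
transitivity ((((1 + 1 : int)%:P + 'X) ^+ n.+1)`_1).
  by rewrite -(coef_sum_numN 1 u 1); apply: eq_bigr => U _; rewrite expr1n mul1r.
have -> : (((1 + 1 : int)%:P + 'X) ^+ n.+1)`_1 = ((((1 + 1 : int)%:P + 'X) ^+ n.+1)^`()).[0].
  by rewrite horner_coef0 coef_deriv mulr1n.
rewrite deriv_exp derivD derivC derivX add0r mul1r hornerMn horner_exp !hornerE /=.
by rewrite natrM natrX mulr_natl.
Qed.

(** The constant term at [s = 1] gives the total $2^{n+1}$; at [s = -1] it gives the difference, the
    constant term of $X^{n+1}$, which is 0. *)
Lemma sum_rest_even_odd u :
  (\sum_(U : {ffun 'I_n.+2 -> ihn} | U i0 == u) rest_even i0 U = 2 ^ n)%N /\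
  (\sum_(U : {ffun 'I_n.+2 -> ihn} | U i0 == u) rest_odd i0 U = 2 ^ n)%N.
Proof.
set E := (\sum_(U | _) nat_of_bool (rest_even i0 U))%N.
set O := (\sum_(U | _) nat_of_bool (rest_odd i0 U))%N.
have add : E%:R + O%:R = 2 ^+ n.+1 :> int.
  transitivity ((((1 + 1 : int)%:P + 'X) ^+ n.+1)`_0).
    rewrite -(coef_sum_numN 1 u 0) /E /O !natr_sum -big_split; apply: eq_bigr => U _ /=.
    rewrite expr1n mul1r /rest_even /rest_odd.
    by case: (_ == _); case: odd.
  by rewrite -horner_coef0 !hornerE.
have sub : E%:R - O%:R = 0 :> int.
  transitivity ((((1 + -1 : int)%:P + 'X) ^+ n.+1)`_0).
    rewrite -(coef_sum_numN (-1) u 0) /E /O !natr_sum -sumrB; apply: eq_bigr => U _ /=.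
    rewrite -signr_odd /rest_even /rest_odd.
    by case: (_ == _); case: odd.
  by rewrite subrr polyC0 add0r coefXn.
have EO : E = O by apply/eqP; rewrite -(eqr_nat int) -subr_eq0 sub.
suff : E = (2 ^ n)%N by rewrite -EO.
apply/eqP; rewrite -(eqn_pmul2l (isT : 0 < 2)%N) -expnS -(eqr_nat int) natrX -add -EO.
by rewrite mul2n -addnn natrD.
Qed.

Lemma sum_by_pin (f : {ffun 'I_n.+2 -> ihn} -> nat) :
  (\sum_U f U = \sum_(U : {ffun 'I_n.+2 -> ihn} | U i0 == TransI) f U
               + \sum_(U : {ffun 'I_n.+2 -> ihn} | U i0 == TransH) f U
               + \sum_(U : {ffun 'I_n.+2 -> ihn} | U i0 == TransN) f U)%N.
Proof. by rewrite (partition_big (fun U : {ffun 'I_n.+2 -> ihn} => U i0) predT) //= sum_ihn. Qed.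

Lemma sum_basis_type : (\sum_U basis_type i0 U = (n + 4) * 2 ^ n)%N.
Proof.
rewrite sum_by_pin; have [eI _] := sum_rest_even_odd TransI.
have [_ oH] := sum_rest_even_odd TransH; have [_ oN] := sum_rest_even_odd TransN.
under [X in (X + _ + _)%N]eq_bigr => U /eqP Ui.
  (* The two cases exclude each other, so their disjunction is counted as a sum. *)
  rewrite (_ : nat_of_bool _ = rest_even i0 U + rest_one i0 U)%N; first over.
  rewrite /basis_type Ui /rest_even /rest_one.
  by case: numN => [|[|?]] //=; case: odd.
rewrite big_split /= eI sum_rest_one.
under eq_bigr => U /eqP Ui do rewrite /basis_type Ui.
under [X in (_ + X)%N]eq_bigr => U /eqP Ui do rewrite /basis_type Ui.
by rewrite oH oN; ring.
Qed.

Lemma sum_real_type : (\sum_U real_type i0 U = (n + 2) * 2 ^ n)%N.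
Proof.
rewrite sum_by_pin; have [eH _] := sum_rest_even_odd TransH.
rewrite big1 => [|U /eqP Ui]; last by rewrite /real_type Ui.
under eq_bigr => U /eqP Ui do rewrite /real_type Ui.
under [X in (_ + X)%N]eq_bigr => U /eqP Ui do rewrite /real_type Ui.
by rewrite eH sum_rest_one; ring.
Qed.

Lemma sum_imag_type : (\sum_U imag_type i0 U = (n + 2) * 2 ^ n)%N.
Proof.
rewrite sum_by_pin; have [eN _] := sum_rest_even_odd TransN.
rewrite big1 => [|U /eqP Ui]; last by rewrite /imag_type Ui.
under eq_bigr => U /eqP Ui do rewrite /imag_type Ui.
under [X in (_ + X)%N]eq_bigr => U /eqP Ui do rewrite /imag_type Ui.
by rewrite eN sum_rest_one; ring.
Qed.

End Counting.

Theorem lemma11 (C : numClosedFieldType) (n m : nat)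
    (hn : (2 <= n)%N) (hm : (2 <= m)%N) :
  num_flat C (@clique_line_clique n m) =
  (2 ^ (n + m - 3) * (3 * n * m + 2 * n + 2 * m + 2))%N.
Proof.
case: n hn => [|[|n]] // _; case: m hm => [|[|m]] // _.
rewrite /num_flat cardsE -sum1_card big_mkcond (reindex _ (onW_bij _ (ffun_join_bij _ _ _))).
(* Since kinds are mutually exclusive, the indicator of flatness is a sum of products of indicators,
   and the double sum splits into products of counts. *)
transitivity (\sum_(U : {ffun 'I_n.+2 -> ihn}) \sum_(V : {ffun 'I_m.+2 -> ihn})
   (basis_type ord_max U * (basis_type ord0 V + imag_type ord0 V)
    + imag_type ord_max U * (basis_type ord0 V + real_type ord0 V)
    + real_type ord_max U * (real_type ord0 V + imag_type ord0 V)))%N.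
  rewrite pair_big; apply: eq_bigr => -[U V] _.
  rewrite -[X in if X then _ else _]/(flat C (@clique_line_clique n.+2 m.+2) (ffun_join U V)).
  rewrite flat_join.
  have [xb xr] := types_exclusive ord_max U; have [xb' xr'] := types_exclusive ord0 V.
  move: xb xr xb' xr' => /=.
  case: (basis_type _ U) => [/(_ isT) -> /(_ isT) ->|_];
    [|case: (real_type _ U) => [/(_ isT) ->|_]];
  (case: (basis_type _ V) => [/(_ isT) -> /(_ isT) ->|_];
    [|case: (real_type _ V) => [/(_ isT) ->|_]]);
  by do ?case: (imag_type _ _).
under eq_bigr do rewrite !big_split -!big_distrr !big_split /=.
rewrite !big_split -!big_distrl /= !sum_basis_type !sum_real_type !sum_imag_type.
(* The truncated subtraction is exact here. The counts supply $2^{n+m}$, and the remaining 2 comes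
   out of the bracket. *)
have -> : (n.+2 + m.+2 - 3 = (n + m).+1)%N by rewrite !addnS !addSn !subSS subn0.
by rewrite expnS expnD; ring.
Qed.
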